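(* Let $\mathcal{C}$ be a flag code of type $(t_1,\dots,t_r)$ on $\mathbb{F}_q^n$ and let $a=\max\{i\in\{1,\dots,r\}\mid 2t_i\leq n\}$ and $b=\min\{i\in\{1,\dots,r\}\mid 2t_i\geq n\}$. The following are equivalent: (i) $\mathcal{C}$ is an optimum distance flag code; (ii) $\mathcal{C}_a$ and $\mathcal{C}_b$ are constant dimension codes of maximum distance with $|\mathcal{C}_a|=|\mathcal{C}_b|=|\mathcal{C}|$.
   Context: $d_S(\mathcal{U},\mathcal{V})=\dim(\mathcal{U}+\mathcal{V})-\dim(\mathcal{U}\cap\mathcal{V})$ for subspaces of $\mathbb{F}_q^n$. A constant dimension code is a nonempty set $\mathcal{C}$ of $k$-dimensional subspaces of $\mathbb{F}_q^n$, with minimum distance $d_S(\mathcal{C})$ the least distance between distinct elements ($0$ if $|\mathcal{C}|=1$); it has maximum distance if $d_S(\mathcal{C})=2k$ when $2k\leq n$ and $d_S(\mathcal{C})=2(n-k)$ when $2k\geq n$. For $0<t_1<\dots<t_r<n$, a flag of type $(t_1,\dots,t_r)$ is a chain $\mathcal{F}_1\subsetneq\cdots\subsetneq\mathcal{F}_r$ of subspaces of $\mathbb{F}_q^n$ with $\dim\mathcal{F}_i=t_i$. A flag code is a nonempty set $\mathcal{C}$ of flags of a fixed type; the flag distance is $d_f(\mathcal{F},\mathcal{F}')=\sum_i d_S(\mathcal{F}_i,\mathcal{F}'_i)$, $d_f(\mathcal{C})$ is the minimum flag distance between distinct flags of $\mathcal{C}$ ($0$ if $|\mathcal{C}|=1$),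 and the $i$-th projected code is $\mathcal{C}_i=\{\mathcal{F}_i\mid\mathcal{F}\in\mathcal{C}\}$. $\mathcal{C}$ is an optimum distance flag code (ODFC) if $d_f(\mathcal{C})=2\left(\sum_{2t_i\leq n}t_i+\sum_{2t_i>n}(n-t_i)\right)$. At least one of the indices $a,b$ exists; if one of them does not exist (the defining set is empty), all conditions referring to it are omitted. *)

(* Defs.v *)
From HB Require Import structures.
From mathcomp Require Import all_boot all_order all_algebra.

Set Implicit Arguments.
Unset Strict Implicit.
Unset Printing Implicit Defensive.

Local Open Scope nat_scope.

(* MathComp declares {vspace vT} only as a choiceType; over a finite field its
   matrix encoding makes it a finType, so that {set {vspace vT}} is usable. *)
HB.instance Definition _ (F : finFieldType) (vT : vectType F) :
    isCountable {vspace vT} :=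
  CanIsCountable (@VectorInternalTheory.vs2mxK F vT).
HB.instance Definition _ (F : finFieldType) (vT : vectType F) :
    isFinite {vspace vT} :=
  CanIsFinite (@VectorInternalTheory.vs2mxK F vT).

(* The least d x y over pairs of distinct elements of C, and 0 when C has no
   such pair: the initial value head 0 s of the iterated minimum belongs to s
   unless s is empty. *)
Definition min_distance (T : finType) (d : T -> T -> nat) (C : {set T}) : nat :=
  let s := [seq d p.1 p.2 | p <- enum (setX C C) & p.1 != p.2] in
  \big[minn/head 0 s]_(x <- s) x.

Section FlagCodes.

Variables (F : finFieldType) (n : nat).

Local Notation subspace := {vspace 'rV[F]_n}.

Definition subspace_distance (U V : subspace) : nat :=
  \dim (U + V) - \dim (U :&: V).

Definition constant_dimension_code (k : nat) (C : {set subspace}) : Prop :=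
  C != set0 /\ {in C, forall U, \dim U = k}.

Definition maximum_distance (k : nat) (C : {set subspace}) : Prop :=
  (2 * k <= n -> min_distance subspace_distance C = 2 * k) /\
  (n <= 2 * k -> min_distance subspace_distance C = 2 * (n - k)).

Variable r : nat.

(* Indices run over 0, ..., r - 1 instead of 1, ..., r. *)
Definition flag_type (t : 'I_r -> nat) : Prop :=
  0 < r /\ (forall i, 0 < t i < n) /\ (forall i j : 'I_r, i < j -> t i < t j).

Local Notation chain := {ffun 'I_r -> subspace}.

Definition is_flag (t : 'I_r -> nat) (X : chain) : Prop :=
  (forall i, \dim (X i) = t i) /\
  (forall i j : 'I_r, i < j -> (X i <= X j)%VS /\ X i != X j).

Definition flag_code (t : 'I_r -> nat) (C : {set chain}) : Prop :=
  C != set0 /\ {in C, forall X, is_flag t X}.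

Definition flag_distance (X Y : chain) : nat :=
  \sum_(i < r) subspace_distance (X i) (Y i).

Definition projected_code (C : {set chain}) (i : 'I_r) : {set subspace} :=
  [set X i | X : chain in C].

Definition optimum_distance (t : 'I_r -> nat) (C : {set chain}) : Prop :=
  min_distance flag_distance C =
    2 * (\sum_(i < r | 2 * t i <= n) t i
         + \sum_(i < r | n < 2 * t i) (n - t i)).

Definition is_index_a (t : 'I_r -> nat) (a : 'I_r) : Prop :=
  2 * t a <= n /\ forall i, 2 * t i <= n -> i <= a.

Definition is_index_b (t : 'I_r -> nat) (b : 'I_r) : Prop :=
  n <= 2 * t b /\ forall i, n <= 2 * t i -> b <= i.

End FlagCodes.

(* Main.v *)
Require Import Defs.
From HB Require Import structures.
From mathcomp Require Import all_boot all_order all_algebra.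
From mathcomp Require Import zify.

(** Two subspaces of dimension [k] are at distance at most
    [2 * minn k (n - k)], so a flag code is an ODFC iff it has at least two
    elements and any two distinct flags attain this bound at every index.
    When [2 * k <= n], attaining it means intersecting trivially, which passes
    to smaller subspaces; when [n <= 2 * k], it means spanning the whole space,
    which passes to larger ones. Hence the indices [a] and [b] control all the
    others. *)

Set Implicit Arguments.
Unset Strict Implicit.
Unset Printing Implicit Defensive.

Local Open Scope nat_scope.

Section MinDistance.

Variables (T : finType) (d : T -> T -> nat).
Implicit Types (C : {set T}) (m : nat).

Lemma bigmin_in (s : seq nat) x0 :
  x0 \in s -> \big[minn/x0]_(x <- s) x \in s.
Proof.
move=> s_x0; rewrite big_seq.
by apply: (big_ind (fun z => z \in s)) => // x y s_x s_y; rewrite /minn; case: ifP.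
Qed.

Lemma bigmin_le (s : seq nat) x0 x : x \in s -> \big[minn/x0]_(y <- s) y <= x.
Proof.
elim: s => // y s IHs; rewrite inE big_cons geq_min.
by case/predU1P=> [-> | /IHs ->]; rewrite ?leqnn ?orbT.
Qed.

Lemma min_distance_le C x y :
  x \in C -> y \in C -> x != y -> min_distance d C <= d x y.
Proof.
move=> Cx Cy xy; apply: bigmin_le; apply/mapP; exists (x, y) => //.
by rewrite mem_filter xy mem_enum inE /= Cx.
Qed.

Lemma min_distance_attained C : 1 < #|C| ->
  exists x y, [/\ x \in C, y \in C, x != y & min_distance d C = d x y].
Proof.
case/card_gt1P=> x [y [Cx Cy xy]]; rewrite /min_distance.
set s := map _ _; have s_xy: d x y \in s.
  by apply/mapP; exists (x, y); rewrite // mem_filter xy mem_enum inE /= Cx.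
(* Since [s] is nonempty, the initial value is a genuine entry and the default 0 never enters the
   minimum. *)
have: \big[minn/head 0 s]_(z <- s) z \in s.
  by apply: bigmin_in; case: (s) s_xy => // z s' _; apply: mem_head.
case/mapP=> -[x' y']; rewrite mem_filter mem_enum inE /=.
by case/and3P=> xy' Cx' Cy' ->; exists x', y'.
Qed.

Lemma min_distance_small C : #|C| <= 1 -> min_distance d C = 0.
Proof.
move=> C_le1; rewrite /min_distance; set s := map _ _.
suff ->: s = [::] by rewrite big_nil.
rewrite /s (eq_in_filter (a2 := pred0)) ?filter_pred0 // => -[x y].
rewrite mem_enum inE => /andP[/= Cx Cy]; apply/negbTE; rewrite negbK.
by apply/eqP; apply: (card_le1_eqP C_le1).
Qed.

(** Positivity of [m] rules out codes with at most one element, whose minimum distance is 0 by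
    convention. For the others, a minimum equal to an upper bound leaves no room for any other
    value. *)
Lemma min_distance_eq_max C m :
    0 < m -> {in C &, forall x y, d x y <= m} ->
  min_distance d C = m <->
  1 < #|C| /\ {in C &, forall x y, x != y -> d x y = m}.
Proof.
move=> m_gt0 d_le; split=> [dC | [C_gt1 d_eq]].
  have C_gt1: 1 < #|C|.
    by case: leqP dC => // /min_distance_small->; case: m m_gt0 {d_le}.
  split=> // x y Cx Cy xy; apply/eqP; rewrite eqn_leq d_le //=.
  by rewrite -dC min_distance_le.
have [x [y [Cx Cy xy ->]]] := min_distance_attained C_gt1.
exact: d_eq.
Qed.

End MinDistance.

Section SubspaceDistance.

Variables (F : finFieldType) (n : nat).
Implicit Types (U V : {vspace 'rV[F]_n}) (k l : nat).

Definition distance_bound k := 2 * minn k (n - k).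

Lemma dim_subspace_le U : \dim U <= n.
Proof. by have := dimvS (subvf U); rewrite dimvf /dim /= mul1n. Qed.

Lemma subspace_distance_cap U V k : \dim U = k -> \dim V = k ->
  subspace_distance U V = 2 * (k - \dim (U :&: V)).
Proof.
move=> dU dV; rewrite /subspace_distance.
have := dimv_sum_cap U V; have := dimvS (capvSl U V); lia.
Qed.

Lemma subspace_distance_add U V k : \dim U = k -> \dim V = k ->
  subspace_distance U V = 2 * (\dim (U + V) - k).
Proof.
move=> dU dV; rewrite /subspace_distance.
have := dimv_sum_cap U V; have := dimvS (capvSl U V).
have := dimvS (addvSl U V); lia.
Qed.

(** The formula with the intersection gives the bound [2 * k], the one with the sum gives
    [2 * (n - k)]. *)
Lemma subspace_distance_le U V k : \dim U = k -> \dim V = k ->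
  subspace_distance U V <= distance_bound k.
Proof.
move=> dU dV; have := subspace_distance_cap dU dV.
have := subspace_distance_add dU dV.
have := dim_subspace_le (U + V); rewrite /distance_bound; lia.
Qed.

(** The bound at [k] is [2 * k], so [U] and [V] meet trivially, and so do [U'] and [V']. As
    [l <= k], the bound at [l] is [2 * l], which is then attained. *)
Lemma subspace_distance_max_sub U V U' V' k l :
    \dim U = k -> \dim V = k -> \dim U' = l -> \dim V' = l ->
    (U' <= U)%VS -> (V' <= V)%VS -> 2 * k <= n ->
  subspace_distance U V = distance_bound k ->
  subspace_distance U' V' = distance_bound l.
Proof.
move=> dU dV dU' dV' sU sV le_kn.
rewrite (subspace_distance_cap dU dV) (subspace_distance_cap dU' dV').
have := dimvS (capvS sU sV); have := dimvS sU; have := dimvS (capvSl U V).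
rewrite /distance_bound; lia.
Qed.

(** Dually, the bound at [k] is [2 * (n - k)], so [U + V] is the whole space, and hence so is
    [U' + V']. *)
Lemma subspace_distance_max_sup U V U' V' k l :
    \dim U = k -> \dim V = k -> \dim U' = l -> \dim V' = l ->
    (U <= U')%VS -> (V <= V')%VS -> n <= 2 * k ->
  subspace_distance U V = distance_bound k ->
  subspace_distance U' V' = distance_bound l.
Proof.
move=> dU dV dU' dV' sU sV le_nk.
rewrite (subspace_distance_add dU dV) (subspace_distance_add dU' dV').
have := dimvS (addvS sU sV); have := dimvS sU.
have := dim_subspace_le (U' + V'); have := dim_subspace_le U'.
have := dimvS (addvSl U V).
rewrite /distance_bound; lia.
Qed.

Lemma maximum_distanceE k (D : {set {vspace 'rV[F]_n}}) :
  maximum_distance k D <->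
  min_distance (@subspace_distance F n) D = distance_bound k.
Proof.
by rewrite /maximum_distance /distance_bound; split; [case=> ? ?| move=> ->]; lia.
Qed.

End SubspaceDistance.

Section FlagCode.

Variables (F : finFieldType) (n r : nat) (t : 'I_r -> nat).
Hypothesis ht : flag_type n t.
Implicit Types X Y : {ffun 'I_r -> {vspace 'rV[F]_n}}.
Variable C : {set {ffun 'I_r -> {vspace 'rV[F]_n}}}.
Hypothesis hC : flag_code t C.

Local Notation bound i := (distance_bound n (t i)).

Lemma distance_bound_gt0 i : 0 < bound i.
Proof. by case: ht => _ [/(_ i) ? _]; rewrite /distance_bound; lia. Qed.

Lemma flag_dim X i : X \in C -> \dim (X i) = t i.
Proof. by move=> CX; case: hC => _ /(_ X CX)[]. Qed.

Lemma flag_subv X (i j : 'I_r) : X \in C -> i <= j -> (X i <= X j)%VS.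
Proof.
move=> CX; rewrite leq_eqVlt => /predU1P[/val_inj-> | lt_ij].
  exact: subvv.
by case: hC => _ /(_ X CX)[_ /(_ i j lt_ij)[]].
Qed.

Lemma component_distance_le X Y i : X \in C -> Y \in C ->
  subspace_distance (X i) (Y i) <= bound i.
Proof. by move=> CX CY; apply: subspace_distance_le; apply: flag_dim. Qed.

(** The pairs range over distinct flags, not distinct components. As the bound is positive, this
    forces the projection to index [i] to be injective on [C]. *)
Definition maximal_at i :=
  {in C &, forall X Y : {ffun 'I_r -> {vspace 'rV[F]_n}},
    X != Y -> subspace_distance (X i) (Y i) = bound i}.

Lemma projected_codeP i :
  constant_dimension_code (t i) (projected_code C i) /\
  maximum_distance (t i) (projected_code C i) /\
  #|projected_code C i| = #|C| <->
  1 < #|C| /\ maximal_at i.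
Proof.
have bnd: {in projected_code C i &, forall U V,
    subspace_distance U V <= bound i}.
  by move=> _ _ /imsetP[X CX ->] /imsetP[Y CY ->]; apply: component_distance_le.
rewrite maximum_distanceE (min_distance_eq_max (distance_bound_gt0 i) bnd).
split=> [[_ [[gt1 dmax] eqC]] | [gt1 dmax]].
  rewrite -eqC; split=> // X Y CX CY XY.
  apply: dmax; [exact: imset_f | exact: imset_f | apply: contra_neq XY].
  (* Equal cardinalities make the projection injective on [C]. *)
  by have /imset_injP := introT eqP eqC; apply.
have eqC: #|projected_code C i| = #|C|.
  apply: card_in_imset => X Y CX CY eqXY; apply/eqP.
  (* Distinct flags sharing this component would be at distance 0 there, against the positive
     bound. *)
  case: eqVneq => // /(dmax X Y CX CY) dXY.
  have := distance_bound_gt0 i; rewrite -dXY eqXY /subspace_distance.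
  by rewrite addvv capvv subnn.
split; last split=> //.
  split; last by move=> _ /imsetP[X CX ->]; apply: flag_dim.
  by rewrite -card_gt0 eqC (ltn_trans _ gt1).
rewrite eqC; split=> // _ _ /imsetP[X CX ->] /imsetP[Y CY ->] XY.
by apply: dmax => //; apply: contraNneq XY => ->.
Qed.

Lemma optimum_distanceP :
  optimum_distance t C <-> 1 < #|C| /\ (forall i, maximal_at i).
Proof.
have sumE: 2 * (\sum_(i < r | 2 * t i <= n) t i
    + \sum_(i < r | n < 2 * t i) (n - t i)) = \sum_(i < r) bound i.
  rewrite [RHS](bigID (fun i => 2 * t i <= n)) /= mulnDr !big_distrr /=.
  congr (_ + _); first by apply: eq_bigr => i; rewrite /distance_bound; lia.
  apply: eq_big => i; first by rewrite ltnNge.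
  by rewrite /distance_bound; lia.
rewrite /optimum_distance sumE min_distance_eq_max.
- split=> -[gt1 dmax]; split=> //.
    move=> i X Y CX CY XY; have /eqP := dmax X Y CX CY XY.
    (* A sum of terms bounded one by one reaches the sum of the bounds only if every term reaches
       its own. *)
    rewrite (leqif_sum (fun j _ => leqif_eq (component_distance_le j CX CY))).
    by move=> /forall_inP/(_ i isT)/eqP.
  by move=> X Y CX CY XY; apply: eq_bigr => i _; apply: dmax.
- case: ht => r_gt0 _; rewrite (bigD1 (Ordinal r_gt0)) //=.
  by rewrite addn_gt0 distance_bound_gt0.
- by move=> X Y CX CY; apply: leq_sum => i _; apply: component_distance_le.
Qed.

Lemma maximal_at_below (i j : 'I_r) :
  i <= j -> 2 * t j <= n -> maximal_at j -> maximal_at i.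
Proof.
move=> le_ij le_jn dmax X Y CX CY XY.
by apply: (subspace_distance_max_sub _ _ _ _ _ _ le_jn (dmax X Y CX CY XY));
  do [exact: flag_dim | exact: flag_subv].
Qed.

Lemma maximal_at_above (i j : 'I_r) :
  j <= i -> n <= 2 * t j -> maximal_at j -> maximal_at i.
Proof.
move=> le_ji le_nj dmax X Y CX CY XY.
by apply: (subspace_distance_max_sup _ _ _ _ _ _ le_nj (dmax X Y CX CY XY));
  do [exact: flag_dim | exact: flag_subv].
Qed.

(** Any index on the lower side witnesses that [a] exists, so a missing [a] needs no separate
    treatment. *)
Lemma exists_index_a (i : 'I_r) :
  2 * t i <= n -> exists2 a : 'I_r, is_index_a n t a & i <= a.
Proof.
move=> le_in.
by case: (@arg_maxnP _ i (fun j => 2 * t j <= n) (@nat_of_ord r) le_in) => a Pa Ma;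
  exists a; [split | apply: Ma].
Qed.

Lemma exists_index_b (i : 'I_r) :
  n <= 2 * t i -> exists2 b : 'I_r, is_index_b n t b & b <= i.
Proof.
move=> le_ni.
by case: (@arg_minnP _ i (fun j => n <= 2 * t j) (@nat_of_ord r) le_ni) => b Pb Mb;
  exists b; [split | apply: Mb].
Qed.

End FlagCode.

Theorem theorem4p8 (F : finFieldType) (n r : nat) (t : 'I_r -> nat)
    (ht : flag_type n t)
    (C : {set {ffun 'I_r -> {vspace 'rV[F]_n}}}) (hC : flag_code t C) :
  optimum_distance t C <->
  ((forall a : 'I_r, is_index_a n t a ->
      constant_dimension_code (t a) (projected_code C a) /\
      maximum_distance (t a) (projected_code C a) /\
      #|projected_code C a| = #|C|) /\
   (forall b : 'I_r, is_index_b n t b ->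
      constant_dimension_code (t b) (projected_code C b) /\
      maximum_distance (t b) (projected_code C b) /\
      #|projected_code C b| = #|C|)).
Proof.
rewrite (optimum_distanceP ht hC); split=> [[gt1 dmax] | [Ha Hb]].
  by split=> i _; apply/(projected_codeP ht hC).
have max_at i: 1 < #|C| /\ maximal_at t C i.
  have [le_in | /ltnW le_ni] := leqP (2 * t i) n.
    have [a ia le_ia] := exists_index_a le_in.
    have /(projected_codeP ht hC)[gt1 dmax] := Ha a ia.
    by split=> //; apply: (maximal_at_below hC le_ia (proj1 ia) dmax).
  have [b ib le_bi] := exists_index_b le_ni.
  have /(projected_codeP ht hC)[gt1 dmax] := Hb b ib.
  by split=> //; apply: (maximal_at_above hC le_bi (proj1 ib) dmax).
(* Some index is needed to extract [1 < #|C|] from [max_at]. *)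
have [r_gt0 _] := ht.
by split=> [|i]; [case: (max_at (Ordinal r_gt0)) | case: (max_at i)].
Qed.
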